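(* Let $f_0\colon\mathbb{R}^n\to\mathbb{R}$ and $F\colon\mathbb{R}^n\to\mathbb{R}^m$ be twice continuously differentiable, let $C:=\bigcup_{i=1}^\ell P_i$ with convex polyhedral sets $P_1,\ldots,P_\ell\subset\mathbb{R}^m$, and consider the problem $\min\{f_0(x)\mid F(x)\in C\}$. Let $\bar x\in\mathbb{R}^n$ be feasible. Assume that for each $u\in\mathcal{C}(\bar x)\setminus\{0\}$ there are $\alpha\ge0$ and a multiplier $$\lambda\in\Lambda^\alpha(\bar x)\cap\bigcap_{i\in J(\bar x;u)}N_{T_{P_i}(F(\bar x))}(\nabla F(\bar x)u)$$ such that $$\nabla^2_{xx}L^\alpha(\bar x,\lambda)(u,u)>0.$$ Then $\bar x$ is an essential local minimizer of second order for this problem.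
   Context: For $\alpha\ge0$: $L^\alpha(x,\lambda):=\alpha f_0(x)+\langle\lambda,F(x)\rangle$ and $\Lambda^\alpha(\bar x):=\{\lambda\in\mathbb{R}^m\mid\nabla_xL^\alpha(\bar x,\lambda)=0\}$; $\nabla^2_{xx}L^\alpha(\bar x,\lambda)(u,u):=u^\top\nabla^2_{xx}L^\alpha(\bar x,\lambda)u$. $T_P(\bar y):=\{v\mid\exists t_k\downarrow0,\,v_k\to v\colon\bar y+t_kv_k\in P\ \forall k\}$ is the tangent cone, and for a closed convex set $K$ and $v\in K$, $N_K(v):=\{y^*\mid\langle y^*,v'-v\rangle\le0\ \forall v'\in K\}$ is the normal cone of convex analysis. $J(F(\bar x)):=\{i\in\{1,\ldots,\ell\}\mid F(\bar x)\in P_i\}$; the critical cone is $$\mathcal{C}(\bar x)=\Bigl\{u\in\mathbb{R}^n\,\Big|\,\nabla F(\bar x)u\in\bigcup_{i\in J(F(\bar x))}T_{P_i}(F(\bar x)),\ \langle\nabla f_0(\bar x),u\rangle\le0\Bigr\},$$ and for $u\in\mathcal{C}(\bar x)$, $J(\bar x;u):=\{i\in J(F(\bar x))\mid\nabla F(\bar x)u\in T_{P_i}(F(\bar x))\}$. A point $\bar x$ is an essential local minimizer of second order for $\min\{f_0(x)\mid F(x)\in C\}$ if $F(\bar x)\in C$ and there exist $\varepsilon>0$ and $\delta>0$ such that $\max\{f_0(x)-f_0(\bar x),\operatorname{dist}(F(x),C)\}\ge\varepsilon\|x-\bar x\|^2$ for all $x$ with $\|x-\bar x\|\le\delta$. 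*)

(* Defs.v *)
From HB Require Import structures.
From mathcomp Require Import all_boot all_order all_algebra.
From mathcomp Require Import all_classical all_reals all_analysis.

Set Implicit Arguments.
Unset Strict Implicit.
Unset Printing Implicit Defensive.

Import Order.TTheory GRing.Theory Num.Theory.
Import numFieldNormedType.Exports.

Local Open Scope classical_set_scope.
Local Open Scope ring_scope.

(* Vectors of R^n are rows 'rV[R]_n, since ['J] is defined for maps between  *)
(* row spaces; it is the transpose of the usual Jacobian matrix, so that the  *)
(* derivative of F at x applied to u is [u *m 'J F x].                        *)

Section Euclidean.
Variables (R : realType) (n : nat).
Implicit Types (u v : 'rV[R]_n) (A : set 'rV[R]_n).

Definition dotv u v : R := \sum_(i < n) u 0 i * v 0 i.

(* The library norm on 'rV[R]_n is the sup norm, hence this definition. *)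
Definition norm2 u : R := Num.sqrt (dotv u u).

(* [inf] is the true infimum only when A is nonempty. *)
Definition dist2 u A : R := inf [set norm2 (u - v) | v in A].

End Euclidean.

Section Derivatives.
Variables (R : realType) (n : nat).
Implicit Types (f : 'rV[R]_n -> R) (x : 'rV[R]_n).

Definition gradient f x : 'rV[R]_n := \row_(j < n) 'D_(delta_mx 0 j) f x.

Definition hessian f x : 'M[R]_n := 'J (gradient f) x.

Definition hessian_form f x (u : 'rV[R]_n) : R := dotv (u *m hessian f x) u.

Definition twice_continuously_differentiable f : Prop :=
  [/\ forall x, differentiable f x,
      forall x, differentiable (gradient f) x
    & continuous (hessian f)].

Definition twice_continuously_differentiable_map m
    (F : 'rV[R]_n -> 'rV[R]_m) : Prop :=
  forall i : 'I_m, twice_continuously_differentiable (fun x => F x 0 i).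

End Derivatives.

Section ConvexSets.
Variables (R : realType) (m : nat).
Implicit Types (K P : set 'rV[R]_m) (y v : 'rV[R]_m).

Definition convex_polyhedral P : Prop :=
  exists (k : nat) (a : 'I_k -> 'rV[R]_m) (b : 'I_k -> R),
    P = [set y | forall j, dotv (a j) y <= b j].

Definition tangent_cone P y : set 'rV[R]_m :=
  [set v | exists (t : nat -> R) (w : nat -> 'rV[R]_m),
     [/\ forall k, 0 < t k,
         t @ \oo --> (0 : R),
         w @ \oo --> v
       & forall k, P (y + t k *: w k)]].

(* Meant for K closed convex and v in K. *)
Definition normal_cone K v : set 'rV[R]_m :=
  [set ystar | forall v', K v' -> dotv ystar (v' - v) <= 0].

End ConvexSets.

Section Problem.
Variables (R : realType) (n m l : nat).
Variables (f0 : 'rV[R]_n -> R) (F : 'rV[R]_n -> 'rV[R]_m).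
Variable P : 'I_l -> set 'rV[R]_m.
Implicit Types (x u : 'rV[R]_n) (y lambda : 'rV[R]_m) (alpha : R).

Definition lagrangian alpha lambda x : R := alpha * f0 x + dotv lambda (F x).

Definition multipliers alpha x : set 'rV[R]_m :=
  [set lambda | gradient (lagrangian alpha lambda) x = 0].

Definition active_pieces y : set 'I_l := [set i | P i y].

Definition critical_cone x : set 'rV[R]_n :=
  [set u | (\bigcup_(i in active_pieces (F x)) tangent_cone (P i) (F x))
             (u *m 'J F x)
           /\ dotv (gradient f0 x) u <= 0].

Definition active_directions x u : set 'I_l :=
  [set i | active_pieces (F x) i /\ tangent_cone (P i) (F x) (u *m 'J F x)].

Definition essential_local_minimizer_second_order
    (C : set 'rV[R]_m) x : Prop :=
  C (F x) /\
  exists eps delta : R, [/\ 0 < eps, 0 < delta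
    & forall z, norm2 (z - x) <= delta ->
        eps * norm2 (z - x) ^+ 2 <= Num.max (f0 z - f0 x) (dist2 (F z) C)].

End Problem.

(* Main.v *)
Require Import Defs.
From mathcomp Require Import all_boot all_order all_algebra.
From mathcomp Require Import all_classical all_reals all_analysis.
From mathcomp Require Import ring lra.

Set Implicit Arguments.
Unset Strict Implicit.
Unset Printing Implicit Defensive.

Import Order.TTheory GRing.Theory Num.Def Num.Theory.
Import numFieldNormedType.Exports.

Local Open Scope classical_set_scope.
Local Open Scope ring_scope.

(** If the growth condition failed at [xbar], there would be points
    [xbar + t h] with [t] tending to [0] and [h] tending to some [u <> 0],
    and points [y] of one fixed piece [P i], such that both the increase of
    [f0] and the distance from [F (xbar + t h)] to [y] are [o(t^2)].  At first
    order this makes [u] critical: [(y - F xbar) / t] has the same limit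
    [u *m 'J F xbar] as the difference quotient of [F], so this vector is
    tangent to [P i], and [f0] does not increase along [u].  Let [alpha] and
    [lambda] be the multipliers attached to [u].  Since [P i] is convex,
    [y - F xbar] is tangent to [P i] at [F xbar], hence
    [dotv lambda (y - F xbar) <= 0], and splitting

      L(xbar + t h) - L(xbar) = alpha (f0(xbar + t h) - f0(xbar))
         + <lambda, F(xbar + t h) - y> + <lambda, y - F xbar>

    bounds the increase of the Lagrangian [L] above by [o(t^2)].  As the
    gradient of [L] vanishes at [xbar], the same increase divided by [t^2]
    tends to half the Hessian form at [u], which is positive: a contradiction
    ([no_violating_sequence]).

    Extracting convergent subsequences is avoided by using the argument one
    direction [u] and one piece at a time ([growth_near_direction]).  It then
    provides a neighbourhood of [u] and a constant, and compactness of the unit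
    sphere together with finiteness of the family of pieces make the constant
    uniform ([uniform_growth]).

    The estimates are carried out in the sup norm; the Euclidean norm lies
    between it and [sqrt n] times it, which only changes the constants. *)

(** * Inner product and norms *)

Section Euclidean.
Variables (R : realType) (n : nat).
Implicit Types u v w : 'rV[R]_n.

Lemma coord_le_norm u i : `|u 0 i| <= `|u|.
Proof.
rewrite [leRHS]/normr /= mx_normrE.
exact: (le_bigmax _ (fun ij : 'I_1 * 'I_n => `|u ij.1 ij.2|) (0, i)).
Qed.

Lemma dotvC u v : dotv u v = dotv v u.
Proof. by apply: eq_bigr => i _; rewrite mulrC. Qed.

Lemma dotvDr u v w : dotv u (v + w) = dotv u v + dotv u w.
Proof. by rewrite -big_split; apply: eq_bigr => i _; rewrite mxE mulrDr. Qed.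

Lemma dotvZr a u v : dotv u (a *: v) = a * dotv u v.
Proof.
by rewrite /dotv mulr_sumr; apply: eq_bigr => i _; rewrite mxE mulrCA.
Qed.

Lemma dotvBr u v w : dotv u (v - w) = dotv u v - dotv u w.
Proof. by rewrite dotvDr -scaleN1r dotvZr mulN1r. Qed.

Lemma ler_dotv u v : dotv u v <= n%:R * `|u| * `|v|.
Proof.
rewrite -mulrA mulr_natl -[X in _ *+ X]card_ord -sumr_const.
apply: ler_sum => i _.
apply: le_trans (ler_norm _) _.
by rewrite normrM ler_pM // coord_le_norm.
Qed.

Lemma norm2_sqr u : norm2 u ^+ 2 = dotv u u.
Proof. by rewrite sqr_sqrtr // sumr_ge0 // => i _; rewrite -expr2 sqr_ge0. Qed.

Lemma norm2_sqr_le u : norm2 u ^+ 2 <= n%:R * `|u| ^+ 2.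
Proof. by rewrite norm2_sqr expr2 mulrA ler_dotv. Qed.

Lemma norm_le_norm2 u : `|u| <= norm2 u.
Proof.
rewrite [leLHS]/normr /= mx_normrE; apply/bigmax_leP; split=> [|[k i] _ /=].
  exact: sqrtr_ge0.
rewrite (ord1 k) -sqrtr_sqr ler_sqrt; last first.
  by rewrite sumr_ge0 // => j _; rewrite -expr2 sqr_ge0.
rewrite /dotv (bigD1 i) //= -expr2 lerDl sumr_ge0 // => j _.
by rewrite -expr2 sqr_ge0.
Qed.

Lemma cvg_dotv T (F : set_system T) (FF : Filter F) (f g : T -> 'rV[R]_n) u v :
  f @ F --> u -> g @ F --> v -> dotv (f k) (g k) @[k --> F] --> dotv u v.
Proof.
move=> fu gv.
apply: (@cvg_big _ _ _ _ _ (@add_continuous R) T F _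
  (fun i k => f k 0 i * g k 0 i) (fun i => u 0 i * v 0 i)) => i _.
have coord : continuous (fun w : 'rV[R]_n => w 0 i).
  exact: coord_continuous.
apply: cvgM; first exact: (continuous_cvg _ (coord u) fu).
exact: (continuous_cvg _ (coord v) gv).
Qed.

End Euclidean.

Lemma cvg_squeeze_dist (R : realType) (V : normedModType R)
    (a : nat -> V) b (c : nat -> R) :
  (forall k, `|a k - b| <= c k) -> c @ \oo --> (0 : R) -> a @ \oo --> b.
Proof.
move=> ac c0; apply/cvgrPdist_le => e e_gt0.
have c_small : \forall k \near \oo, `|c k| <= e by exact: cvgr0_norm_le.
near=> k; have ck : `|c k| <= e by near: k.
by rewrite distrC (le_trans (ac k)) // (le_trans (ler_norm _)).
Unshelve. all: by end_near. Qed.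

(** * First- and second-order difference quotients *)

Section Differentials.
Variables (R : realType) (n : nat).

Lemma differentiable_row m (F : 'rV[R]_n -> 'rV[R]_m) x :
  (forall i, differentiable (fun z => F z 0 i) x) -> differentiable F x.
Proof.
move=> dF.
rewrite (_ : F = \sum_(i < m) (fun z => F z 0 i *: delta_mx 0 i)); last first.
  by rewrite funeqE => z; rewrite fct_sumE [LHS]row_sum_delta.
by apply: differentiable_sum => i; exact: differentiableZl.
Qed.

Lemma diff_gradient (f : 'rV[R]_n -> R) x u :
  differentiable f x -> 'd f x u = dotv (gradient f x) u.
Proof.
move=> df; rewrite {1}[u]row_sum_delta linear_sum; apply: eq_bigr => i _.
by rewrite linearZ /= mxE deriveE // mulrC.
Qed.

Lemma diff_jacobian m (F : 'rV[R]_n -> 'rV[R]_m) x u :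
  'd F x u = u *m 'J F x.
Proof. by rewrite mul_rV_lin1. Qed.

(** A difference quotient along a curve tangent to [u]: the directions [h] may
    vary, because the remainder [r] is small relative to [t h], whose norm is
    at most a constant times [t]. *)
Lemma cvg_diff_quotient (W : normedModType R) (f : 'rV[R]_n -> W) x u
    T (G : set_system T) (FG : Filter G) (t : T -> R) (h : T -> 'rV[R]_n) :
  differentiable f x -> (forall k, 0 < t k) ->
  t @ G --> (0 : R) -> h @ G --> u ->
  (t k)^-1 *: (f (x + t k *: h k) - f x) @[k --> G] --> 'd f x u.
Proof.
move=> df t_gt0 t0 hu.
pose r z := f (z + x) - (f x + 'd f x z).
have r_small e : 0 < e -> \forall z \near (0 : 'rV[R]_n), `|r z| <= e * `|z|.
  by move=> e_gt0; exact: (eqadd_some_oP (diff_locally df)).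
have -> : (fun k => (t k)^-1 *: (f (x + t k *: h k) - f x)) =
    (fun k => 'd f x (h k) + (t k)^-1 *: r (t k *: h k)).
  apply/funext => k; rewrite /r [x + _]addrC opprD addrA [in RHS]scalerBr.
  have -> : 'd f x (t k *: h k) = t k *: 'd f x (h k) by exact: linearZ.
  by rewrite scalerA mulVf ?gt_eqF // scale1r [RHS]addrC subrK.
rewrite -[X in _ --> X]addr0; apply: cvgD.
  by apply: (cvg_comp _ _ hu); exact: (diff_continuous df).
have th0 : (t k *: h k) @[k --> G] --> (0 : 'rV[R]_n).
  by rewrite -(scale0r u); exact: cvgZ.
apply/cvgr0Pnorm_lt => e e_gt0.
have u1_gt0 : 0 < `|u| + 1 by rewrite ltr_pwDr.
have h_bounded : \forall k \near G, `|h k| < `|u| + 1.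
  have : `|h k| @[k --> G] --> `|u| by exact: cvg_norm.
  by move/cvgr_lt; apply; rewrite ltrDl.
have rth : \forall k \near G,
    `|r (t k *: h k)| <= e / (`|u| + 1) * `|t k *: h k|.
  exact: (th0 _ (r_small _ (divr_gt0 e_gt0 u1_gt0))).
near=> k.
rewrite normrZ normfV gtr0_norm // ltr_pdivrMl //.
have : `|r (t k *: h k)| <= e / (`|u| + 1) * `|t k *: h k| by near: k.
move/le_lt_trans; apply.
rewrite normrZ gtr0_norm // mulrCA ltr_pM2l //.
rewrite -mulrA gtr_pMr // ltr_pdivrMl // mulr1.
by near: k.
Unshelve. all: by end_near. Qed.

(** Cauchy's form of the second-order mean value theorem: Rolle's theorem for
    [s |-> t^2 f(x + s h) - s^2 (f(x + t h) - f(x))], which takes the same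
    value at [0] and [t]. *)
Lemma second_order_mean_value (f : 'rV[R]_n -> R) (x h : 'rV[R]_n) (t : R) :
  (forall z, differentiable f z) -> 0 < t ->
  exists2 s, 0 < s < t &
    t ^+ 2 * dotv (gradient f (x + s *: h)) h
      = 2 * s * (f (x + t *: h) - f x).
Proof.
move=> df t_gt0; set D := f (x + t *: h) - f x.
have df_line (s : R) : is_derive s 1 (fun s : R => f (x + s *: h))
    (dotv (gradient f (x + s *: h)) h).
  (* Both derivatives are limits of the same difference quotient. *)
  have E : (fun e : R => e^-1 *: (((fun s : R => f (x + s *: h)) \o shift s)
        (e *: 1) - f (x + s *: h))) =
      (fun e : R => e^-1 *: ((f \o shift (x + s *: h)) (e *: h)
        - f (x + s *: h))).
    by apply/funext => e /=; rewrite /shift /= [e *: 1]mulr1 scalerDl addrCA.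
  have dfh : derivable f (x + s *: h) h by exact: diff_derivable.
  rewrite -(diff_gradient h (df _)) -(deriveE h (df _)).
  by split; rewrite /derivable /derive E.
pose g (s : R) : R := t ^+ 2 * f (x + s *: h) - s ^+ 2 * D.
have dg (s : R) : is_derive s 1 g
    (t ^+ 2 * dotv (gradient f (x + s *: h)) h - 2 * s * D).
  have -> : g = t ^+ 2 \*: (fun s : R => f (x + s *: h)) - D \*: (@id R) ^+ 2.
    by apply/funext => z; rewrite /g /= !fctE; congr (_ - _); exact: mulrC.
  by apply: is_derive_eq; rewrite /= /GRing.scale /=; ring.
have g_cont : {within `[0, t], continuous g}.
  by apply: derivable_within_continuous => s _; exact: ex_derive.
have g0t : g 0 = g t by rewrite /g /D scale0r addr0; ring.
have [s s_in [_ gs0]] :=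
  Rolle t_gt0 (fun s _ => ex_derive (is_derive := dg s)) g_cont g0t.
exists s; first by move: s_in; rewrite in_itv.
by apply/eqP; rewrite -subr_eq0 -(derive_val (is_derive := dg s)) gs0.
Qed.

(** The mean value theorem above turns the second-order quotient of [f] into
    a first-order quotient of its gradient, so that differentiability of the
    gradient at the single point [x] suffices. *)
Lemma cvg_second_order (f : 'rV[R]_n -> R) (x u : 'rV[R]_n)
    T (G : set_system T) (FG : Filter G) (t : T -> R) (h : T -> 'rV[R]_n) :
  (forall z, differentiable f z) -> differentiable (gradient f) x ->
  gradient f x = 0 -> (forall k, 0 < t k) ->
  t @ G --> (0 : R) -> h @ G --> u ->
  (t k ^+ 2)^-1 * (f (x + t k *: h k) - f x) @[k --> G] -->
    2^-1 * hessian_form f x u.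
Proof.
move=> df dgf gf0 t_gt0 t0 hu.
have /choice[s sP] k : exists s, 0 < s < t k /\
    t k ^+ 2 * dotv (gradient f (x + s *: h k)) (h k)
      = 2 * s * (f (x + t k *: h k) - f x).
  by have [s] := second_order_mean_value x (h k) df (t_gt0 k); exists s.
have s_gt0 k : 0 < s k by have [/andP[]] := sP k.
have s0 : s @ G --> (0 : R).
  apply: (@squeeze_cvgr _ _ _ _ (cst 0) t); [|exact: cvg_cst|exact: t0].
  by near=> k; have [/andP[/ltW -> /ltW ->]] := sP k.
have -> : (fun k => (t k ^+ 2)^-1 * (f (x + t k *: h k) - f x)) =
    (fun k => 2^-1 *
      dotv ((s k)^-1 *: (gradient f (x + s k *: h k) - gradient f x)) (h k)).
  apply/funext => k; have [_ E] := sP k.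
  rewrite gf0 subr0 dotvC dotvZr.
  have t2 : t k != 0 by rewrite gt_eqF.
  have s1 : s k != 0 by rewrite gt_eqF.
  have -> : f (x + t k *: h k) - f x =
      t k ^+ 2 * dotv (gradient f (x + s k *: h k)) (h k) / (2 * s k).
    by rewrite E; field.
  by rewrite dotvC; field; rewrite t2 s1.
apply: cvgM; first exact: cvg_cst.
rewrite /hessian_form /hessian -diff_jacobian.
exact: cvg_dotv (cvg_diff_quotient _ _ _ _ _) _.
Unshelve. all: by end_near. Qed.

End Differentials.

(** * Smoothness of the Lagrangian *)

Section Lagrangian.
Variables (R : realType) (n m : nat).
Variables (f0 : 'rV[R]_n -> R) (F : 'rV[R]_n -> 'rV[R]_m).
Variables (alpha : R) (lambda : 'rV[R]_m).
Hypothesis (f0_C2 : twice_continuously_differentiable f0).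
Hypothesis (F_C2 : twice_continuously_differentiable_map F).

Local Notation L := (lagrangian f0 F alpha lambda).

Lemma lagrangian_sum :
  L = alpha \*: f0 + \sum_(i < m) (lambda 0 i \*: (fun z => F z 0 i)).
Proof. by apply/funext => z; rewrite !fctE fct_sumE. Qed.

Lemma differentiable_lagrangian z : differentiable L z.
Proof.
rewrite lagrangian_sum; apply: differentiableD.
  by apply: differentiableZ; have [] := f0_C2.
by apply: differentiable_sum => i; apply: differentiableZ; have [] := F_C2 i.
Qed.

Lemma gradient_lagrangian :
  gradient L = alpha \*: gradient f0
    + \sum_(i < m) (lambda 0 i \*: gradient (fun z => F z 0 i)).
Proof.
have df0 z v : derivable f0 z v.
  by apply: diff_derivable; have [] := f0_C2.
have dF i z v : derivable (fun z => F z 0 i) z v.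
  by apply: diff_derivable; have [] := F_C2 i.
apply/funext => z; rewrite !fctE fct_sumE; apply/rowP => j.
rewrite mxE lagrangian_sum deriveD; last 2 first.
- exact: derivableZ.
- by apply: derivable_sum => i; exact: derivableZ.
rewrite deriveZ // derive_sum => [|i]; last exact: derivableZ.
rewrite !mxE summxE; congr (_ + _); apply: eq_bigr => i _.
by rewrite deriveZ // !mxE.
Qed.

Lemma differentiable_gradient_lagrangian z : differentiable (gradient L) z.
Proof.
rewrite gradient_lagrangian; apply: differentiableD.
  by apply: differentiableZ; have [] := f0_C2.
by apply: differentiable_sum => i; apply: differentiableZ; have [] := F_C2 i.
Qed.

End Lagrangian.

(** * Polyhedra, tangent cones and normal cones *)

Section Cones.
Variables (R : realType) (m : nat).
Implicit Types (P K : set 'rV[R]_m) (y z v lambda : 'rV[R]_m).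

Lemma polyhedral_cvg P T (G : set_system T) (FG : ProperFilter G)
    (y_ : T -> 'rV[R]_m) y :
  convex_polyhedral P -> (forall k, P (y_ k)) -> y_ @ G --> y -> P y.
Proof.
move=> [p [a [b ->]]] Py yy j.
have ay : dotv (a j) (y_ k) @[k --> G] --> dotv (a j) y.
  by apply: cvg_dotv => //; exact: cvg_cst.
apply: (cvgr_to_le ay).
by apply: nearW => k; exact: Py.
Qed.

Lemma polyhedral_segment P y z s : convex_polyhedral P -> P y -> P z ->
  0 <= s <= 1 -> P (y + s *: (z - y)).
Proof.
move=> [p [a [b ->]]] /= Py Pz /andP[s0 s1] j.
have {}Py := Py j; have {}Pz := Pz j.
rewrite dotvDr dotvZr dotvBr; nra.
Qed.

(** By convexity the direction from [y] to [z] is feasible, so the constant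
    sequence [z - y] witnesses tangency. *)
Lemma tangent_cone_sub P y z :
  convex_polyhedral P -> P y -> P z -> tangent_cone P y (z - y).
Proof.
move=> cP Py Pz; exists harmonic, (fun=> z - y); split.
- exact: harmonic_gt0.
- exact: cvg_harmonic.
- exact: cvg_cst.
- move=> k; apply: polyhedral_segment => //.
  by rewrite harmonic_ge0 /= invf_le1 ?ler1n ?ltr0n.
Qed.

Lemma tangent_coneZ P y v c :
  0 < c -> tangent_cone P y v -> tangent_cone P y (c *: v).
Proof.
move=> c_gt0 [t [w [t_gt0 t0 wv Pw]]].
exists (fun k => t k / c), (fun k => c *: w k); split.
- by move=> k; exact: divr_gt0.
- by rewrite -(mul0r c^-1); apply: cvgM => //; exact: cvg_cst.
- by apply: cvgZ => //; exact: cvg_cst.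
- by move=> k; rewrite scalerA divfK ?gt_eqF.
Qed.

(** On a cone, a normal at [v] is a normal at [0]: testing normality with
    [2 v] gives [dotv lambda v <= 0], and adding the inequality for [w] removes
    the base point. *)
Lemma normal_cone_le0 K v w lambda :
  (forall z, K z -> K (2 *: z)) -> K v -> K w ->
  normal_cone K v lambda -> dotv lambda w <= 0.
Proof.
move=> K2 Kv Kw Nl.
have := Nl _ (K2 _ Kv); have := Nl _ Kw.
by rewrite !dotvBr dotvZr; lra.
Qed.

End Cones.

(** * Quadratic growth near the feasible point *)

Section LocalGrowth.
Variables (R : realType) (n m l : nat).
Variables (f0 : 'rV[R]_n -> R) (F : 'rV[R]_n -> 'rV[R]_m).
Variables (P : 'I_l -> set 'rV[R]_m) (x : 'rV[R]_n).
Hypothesis (f0_C2 : twice_continuously_differentiable f0).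
Hypothesis (F_C2 : twice_continuously_differentiable_map F).
Hypothesis (P_polyhedral : forall i, convex_polyhedral (P i)).

Definition second_order_multiplier u alpha lambda :=
  [/\ 0 <= alpha,
      (multipliers f0 F alpha x `&`
       \bigcap_(i in active_directions F P x u)
         normal_cone (tangent_cone (P i) (F x)) (u *m 'J F x)) lambda
    & 0 < hessian_form (lagrangian f0 F alpha lambda) x u].

(** Divided by [t], the bounds on [F] and [f0] show that [u] is critical and
    that [P i] is active in the direction [u]; divided by [t^2], they bound
    half the Hessian form of the Lagrangian at [u] by the limit of
    [(alpha + m |lambda|) e], which is [0]. *)
Lemma no_violating_sequence u i (e t : nat -> R) (h : nat -> 'rV[R]_n)
    (y : nat -> 'rV[R]_m) :
  (critical_cone f0 F P x u ->
     exists alpha lambda, second_order_multiplier u alpha lambda) ->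
  e @ \oo --> (0 : R) ->
  (forall k, 0 < t k) -> t @ \oo --> (0 : R) ->
  h @ \oo --> u ->
  (forall k, P i (y k)) ->
  (forall k, `|F (x + t k *: h k) - y k| < e k * t k ^+ 2) ->
  (forall k, f0 (x + t k *: h k) - f0 x < e k * t k ^+ 2) ->
  False.
Proof.
move=> multiplier_ex e0 t_gt0 t0 hu Py Fy f0y.
have t_neq0 k : t k != 0 by rewrite gt_eqF.
have et0 : e k * t k @[k --> \oo] --> (0 : R).
  by rewrite -(mul0r 0); exact: cvgM.
pose w k := (t k)^-1 *: (y k - F x).
have yE k : F x + t k *: w k = y k.
  by rewrite scalerA divff // scale1r addrC subrK.
have w_cvg : w @ \oo --> u *m 'J F x.
  rewrite -diff_jacobian.
  have dF : differentiable F x.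
    by apply: differentiable_row => j; have [] := F_C2 j.
  pose q k := (t k)^-1 *: (F (x + t k *: h k) - F x).
  have q_cvg : q @ \oo --> 'd F x u by exact: cvg_diff_quotient.
  have wq : (w - q) @ \oo --> (0 : 'rV[R]_m).
    apply: cvg_squeeze_dist et0 => k.
    rewrite subr0 !fctE /w /q -scalerBr opprB addrA subrK normrZ distrC.
    rewrite gtr0_norm ?invr_gt0 // ler_pdivrMl // mulrCA -expr2.
    exact: ltW.
  have -> : w = q + (w - q) by rewrite addrC subrK.
  by rewrite -['d F x u]addr0; exact: cvgD.
have PFx : P i (F x).
  have y_cvg : y @ \oo --> F x.
    have -> : y = (fun k => F x + t k *: w k) by apply/funext => k; rewrite yE.
    rewrite -[X in _ --> X]addr0 -(scale0r (u *m 'J F x)).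
    by apply: cvgD; [exact: cvg_cst|exact: cvgZ].
  exact: polyhedral_cvg Py y_cvg.
have u_tangent : tangent_cone (P i) (F x) (u *m 'J F x).
  by exists t, w; split => // k; rewrite yE.
have u_critical : critical_cone f0 F P x u.
  split; first by exists i.
  have df0 : differentiable f0 x by have [] := f0_C2.
  rewrite -diff_gradient //.
  apply: (ler_cvg_to (cvg_diff_quotient _ df0 t_gt0 t0 hu) et0).
  apply: nearW => k; rewrite ler_pdivrMl // mulrCA -expr2.
  exact: ltW.
have [alpha [lambda [alpha_ge0 [grad0 normal] hess_gt0]]] :=
  multiplier_ex u_critical.
have lambda_normal :
    normal_cone (tangent_cone (P i) (F x)) (u *m 'J F x) lambda.
  by apply: normal; split.
have lambda_le0 k : dotv lambda (y k - F x) <= 0.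
  have y_tangent := tangent_cone_sub (P_polyhedral i) PFx (Py k).
  apply: normal_cone_le0 u_tangent y_tangent lambda_normal => z.
  exact: tangent_coneZ.
have L2 := cvg_second_order eventually_filter
  (differentiable_lagrangian alpha lambda f0_C2 F_C2)
  (differentiable_gradient_lagrangian alpha lambda f0_C2 F_C2 x)
  grad0 t_gt0 t0 hu.
pose c := alpha + m%:R * `|lambda|.
have ce0 : c * e k @[k --> \oo] --> (0 : R).
  by rewrite -(mulr0 c); apply: cvgM => //; exact: cvg_cst.
suff : 2^-1 * hessian_form (lagrangian f0 F alpha lambda) x u <= 0.
  by rewrite leNgt mulr_gt0.
apply: (ler_cvg_to L2 ce0); apply: nearW => k.
rewrite ler_pdivrMl ?exprn_gt0 // /lagrangian.
set z := x + _.
have -> : alpha * f0 z + dotv lambda (F z) - (alpha * f0 x + dotv lambda (F x))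
    = alpha * (f0 z - f0 x) + dotv lambda (F z - y k) + dotv lambda (y k - F x).
  by rewrite !dotvBr; ring.
have := ler_wpM2l alpha_ge0 (ltW (f0y k)).
have := le_trans (ler_dotv lambda (F z - y k))
  (ler_wpM2l (mulr_ge0 (ler0n _ m) (normr_ge0 lambda)) (ltW (Fy k))).
have := lambda_le0 k.
rewrite /c -/z; lra.
Qed.

(** Each violation of the bound with constant [e = 1 / (k + 1)] provides one
    term of a sequence excluded by the previous lemma. *)
Lemma growth_near_direction u i :
  (critical_cone f0 F P x u ->
     exists alpha lambda, second_order_multiplier u alpha lambda) ->
  exists2 e, 0 < e & forall t h y, 0 < t < e -> `|h - u| < e -> P i y ->
    `|F (x + t *: h) - y| < e * t ^+ 2 ->
    e * t ^+ 2 <= f0 (x + t *: h) - f0 x.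
Proof.
move=> multiplier_ex; apply: contrapT => no_e.
have /choice[p pP] : forall k, exists p : R * 'rV[R]_n * 'rV[R]_m,
    [/\ 0 < p.1.1 < harmonic k, `|p.1.2 - u| < harmonic k, P i p.2,
      `|F (x + p.1.1 *: p.1.2) - p.2| < harmonic k * p.1.1 ^+ 2
    & f0 (x + p.1.1 *: p.1.2) - f0 x < harmonic k * p.1.1 ^+ 2].
  move=> k; apply: contrapT => no_p; apply: no_e; exists (harmonic k).
    exact: harmonic_gt0.
  move=> t h y tk hk Py Fy; rewrite leNgt; apply/negP => f0y.
  by apply: no_p; exists (t, h, y).
have t_gt0 k : 0 < (p k).1.1 by have [/andP[]] := pP k.
apply: (@no_violating_sequence u i harmonic (fun k => (p k).1.1)
  (fun k => (p k).1.2) (fun k => (p k).2)) => //.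
- exact: cvg_harmonic.
- apply: (cvg_squeeze_dist _ cvg_harmonic) => k.
  by rewrite subr0 gtr0_norm // ltW //; have [/andP[]] := pP k.
- apply: (cvg_squeeze_dist _ cvg_harmonic) => k.
  by rewrite ltW //; have [] := pP k.
- by move=> k; have [] := pP k.
- by move=> k; have [] := pP k.
- by move=> k; have [] := pP k.
Qed.

(** Compactness: the bound of [growth_near_direction] survives when [e]
    decreases, so it holds for [h] near [u] and all small [e], and the unit
    sphere is covered by finitely many such neighbourhoods. *)
Lemma uniform_growth :
  (forall u, critical_cone f0 F P x u -> u <> 0 ->
     exists alpha lambda, second_order_multiplier u alpha lambda) ->
  exists2 e, 0 < e & forall z i y, `|z - x| < e -> P i y ->
    `|F z - y| < e * `|z - x| ^+ 2 -> e * `|z - x| ^+ 2 <= f0 z - f0 x.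
Proof.
move=> multiplier_ex.
pose Q e h i := forall t y, 0 < t < e -> P i y ->
    `|F (x + t *: h) - y| < e * t ^+ 2 ->
    e * t ^+ 2 <= f0 (x + t *: h) - f0 x.
pose S := [set u : 'rV[R]_n | `|u| = 1].
have S_compact : compact S.
  apply: bounded_closed_compact.
    exists 1; split; first exact: num_real.
    by move=> r /ltW r1 u /= ->.
  have /continuous_closedP := @norm_continuous R 'rV[R]_n.
  by move=> /(_ _ (@closed_eq R 1)).
have Q_near : forall u, S u ->
    \forall h \near u & e \near (0 : R)^'+, forall i, Q e h i.
  move=> u Su.
  suff Q_near_i i : \forall h \near u & e \near (0 : R)^'+, Q e h i.
    exact: (@filter_forall _ _ (fun i he => Q he.2 he.1 i) _ _ Q_near_i).
  have u_neq0 : u <> 0.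
    move=> u0; move: Su; rewrite /S /= u0 normr0 => /esym/eqP.
    by rewrite oner_eq0.
  have [r r_gt0 rP] :=
    growth_near_direction i (fun uc => multiplier_ex u uc u_neq0).
  exists (ball u r, [set e | 0 < e < r]).
    split; first exact: nbhsx_ballx.
    by apply: filterS2 (nbhs_right_gt 0) (nbhs_right_lt r_gt0) => e /= -> ->.
  move=> [h e] /= [uh /andP[e_gt0 er]] t y /andP[t_gt0 te] Py Fy.
  have er2 : e * t ^+ 2 <= r * t ^+ 2 by rewrite ler_wpM2r ?sqr_ge0 // ltW.
  apply: (le_trans er2); apply: (rP _ _ y) => //.
  - by rewrite t_gt0 (lt_trans te).
  - by move: uh; rewrite -ball_normE /= distrC.
  - exact: lt_le_trans Fy er2.
have SQ : \forall e \near (0 : R)^'+, S `<=` (fun h => forall i, Q e h i).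
  exact: (compact_near_coveringP S).1 S_compact _ _ _ _ Q_near.
have [e [e_gt0 eQ]] := filter_ex (filterI (nbhs_right_gt 0) SQ).
exists e => // z i y ze Py Fy.
have [zx0|zx_neq0] := eqVneq (z - x) 0.
  move/eqP: zx0; rewrite subr_eq0 => /eqP ->.
  by rewrite !subrr normr0 expr0n mulr0.
have t_gt0 : 0 < `|z - x| by rewrite normr_gt0.
have zE : x + `|z - x| *: (`|z - x|^-1 *: (z - x)) = z.
  by rewrite scalerA divff ?gt_eqF // scale1r addrC subrK.
have := eQ (`|z - x|^-1 *: (z - x)) _ i `|z - x| y; rewrite zE; apply => //.
  by rewrite /S /= normrZ normfV normr_id mulVf // gt_eqF.
by rewrite t_gt0.
Qed.

End LocalGrowth.

(** * Sufficiency of the second-order condition *)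

Theorem theorem5p4 (R : realType) (n m l : nat)
    (f0 : 'rV[R]_n -> R) (F : 'rV[R]_n -> 'rV[R]_m)
    (P : 'I_l -> set 'rV[R]_m) (xbar : 'rV[R]_n)
    (hf0 : twice_continuously_differentiable f0)
    (hF : twice_continuously_differentiable_map F)
    (hP : forall i, convex_polyhedral (P i))
    (hfeas : (\bigcup_i P i) (F xbar))
    (hsoc : forall u, critical_cone f0 F P xbar u -> u <> 0 ->
      exists (alpha : R) (lambda : 'rV[R]_m),
        [/\ 0 <= alpha,
            (multipliers f0 F alpha xbar `&`
             \bigcap_(i in active_directions F P xbar u)
               normal_cone (tangent_cone (P i) (F xbar)) (u *m 'J F xbar))
              lambda
          & 0 < hessian_form (lagrangian f0 F alpha lambda) xbar u]) :
  essential_local_minimizer_second_order f0 F (\bigcup_i P i) xbar.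
Proof.
split=> //.
have [e e_gt0 growth] := uniform_growth hf0 hF hP hsoc.
(* The squared Euclidean norm is at most n times the squared sup norm; n + 1
   keeps the divisor nonzero in dimension 0. *)
exists (e / n.+1%:R), (e / 2); split; [exact: divr_gt0|exact: divr_gt0|].
move=> z z_near.
have ze : `|z - xbar| < e.
  by apply: le_lt_trans (norm_le_norm2 _) (le_lt_trans z_near _); lra.
have norms : e / n.+1%:R * norm2 (z - xbar) ^+ 2 <= e * `|z - xbar| ^+ 2.
  rewrite -mulrA ler_pM2l // ler_pdivrMl // (le_trans (norm2_sqr_le _)) //.
  by rewrite ler_wpM2r ?sqr_ge0 // ler_nat.
apply: le_trans norms _; rewrite le_max.
have [//|f0_small /=] := leP (e * `|z - xbar| ^+ 2) (f0 z - f0 xbar).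
apply: lb_le_inf => [|_ [y [i _ Py] <-]].
  by exists (norm2 (F z - F xbar)), (F xbar).
rewrite leNgt; apply/negP => Fzy; move: f0_small; rewrite ltNge => /negP; apply.
exact: growth ze Py (le_lt_trans (norm_le_norm2 _) Fzy).
Qed.
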